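(* Let $(S,\cdot,\lambda)$ be a standard positive semigroup, let $\boldsymbol{X}=(X_1,X_2,\ldots)$ be an IID sequence in $S$ with a common PDF with respect to $\lambda$, let $\boldsymbol{Y}$ be the sequence of ladder variables and $\boldsymbol{Z}$ the partial product sequence associated with $\boldsymbol{X}$. If $\boldsymbol{Y}$ and $\boldsymbol{Z}$ are equivalent (have the same distribution as processes), then the underlying distribution of $\boldsymbol{X}$ is exponential.
   Context: A positive semigroup $(S,\cdot)$ is a semigroup with identity $e$ satisfying the left-cancellation law and having no non-trivial inverses; its partial order is $x\preceq y$ iff $xt=y$ for some $t\in S$ (such $t$ is unique and denoted $x^{-1}y$). It is standard, with reference measure $\lambda$, if: $S$ has a topology that is locally compact, locally convex (every point has a neighborhood base of convex sets, where $A$ is convex if $a,b\in A$, $a\preceq x\preceq b$ imply $x\in A$) and has a countable base; $\{(x,y)\in S^2: x\preceq y\}$ is closed in $S^2$; $D[x]=\{t: t\preceq x\}$ is compact for each $x\in S$; $(x,y)\mapsto xy$ is continuous; $\lambda$ is a positive Borel measure, finite on compact sets, with $\lambda(V)>0$ for every nonempty open $V$, and left-invariant: $\lambda(xA)=\lambda(A)$ for $x\in S$ and $A\in\mathcal{B}(S)$ (the Borel $\sigma$-algebra). Random variables $X$ in $S$ have a Borel distribution with support $S$; the upper probability function is $F(x)=\mathbb{P}(X\succeq x)$, assumed to take values in $(0,1]$. The distribution of $X$ is exponential if $\mathbb{P}(X\in xA)=F(x)\,\mathbb{P}(X\in A)$ for all $x\in S$, $A\in\mathcal{B}(S)$. Ladder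 variables: $N_1=1$, $Y_1=X_1$, and recursively $N_{n+1}=\min\{k>N_n: X_k\succeq Y_n\}$, $Y_{n+1}=X_{N_{n+1}}$. Partial products: $Z_n=X_1X_2\cdots X_n$. *)

(* Defs.v *)
From HB Require Import structures.
From mathcomp Require Import all_boot all_order all_algebra.
From mathcomp Require Import finmap.
From mathcomp Require Import all_classical all_reals all_analysis.

Set Implicit Arguments.
Unset Strict Implicit.
Unset Printing Implicit Defensive.

Local Open Scope classical_set_scope.
Local Open Scope group_scope.

(* No compatibility between the product and the topology is built in: joint
   continuity is a field of [standard_positive_semigroup].  The distinguished
   point of the pointed type is required by measurable types; it plays no
   role. *)
#[short(type="ptopMonoidType")]
HB.structure Definition PointedTopologicalMonoid :=
  {S of PointedTopological S & Monoid S}.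

Section PositiveSemigroup.
Variable S : ptopMonoidType.
Implicit Types x y t : S.

Record positive_semigroup : Prop := PositiveSemigroup {
  left_cancel : forall x y t, x * y = x * t -> y = t ;
  no_inverse : forall x y, x * y = 1 -> y * x = 1 -> x = 1 }.

Definition sle x y : Prop := exists t, x * t = y.

Definition lset x : set S := [set t | sle t x].

Definition uset x : set S := [set t | sle x t].

Definition translate x (A : set S) : set S := [set x * a | a in A].

Definition sconvex (A : set S) : Prop :=
  forall a b x, A a -> A b -> sle a x -> sle x b -> A x.

Definition locally_sconvex : Prop :=
  forall x (U : set S), nbhs x U ->
    exists A : set S, [/\ nbhs x A, sconvex A & A `<=` U].

End PositiveSemigroup.

Notation borelType T := (g_sigma_algebraType (@open T)).

Section Standard.
Local Open Scope ring_scope.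
Local Open Scope ereal_scope.
Variables (R : realType) (S : ptopMonoidType).

Record standard_positive_semigroup
    (lambda : {measure set (borelType S) -> \bar R}) : Prop := Standard {
  std_positive : positive_semigroup S ;
  std_locally_compact : locally_compact [set: S] ;
  std_locally_convex : locally_sconvex S ;
  std_second_countable : @second_countable S ;
  std_closed_order : closed [set xy : S * S | sle xy.1 xy.2] ;
  std_compact_lset : forall x : S, compact (lset x) ;
  std_continuous_mul : continuous (fun xy : S * S => (xy.1 * xy.2)%g) ;
  std_finite_compact : forall K : set S, compact K -> lambda K < +oo ;
  std_open_gt0 : forall V : set S, open V -> V !=set0 -> 0 < lambda V ;
  std_left_invariant : forall (x : S) (A : set (borelType S)),
    measurable A -> lambda (translate x A) = lambda A }.

Section Distribution.
Variable mu : probability (borelType S) R.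

Definition measure_support : set S :=
  [set x | forall U : set S, open U -> U x -> 0 < mu U].

Definition upf (x : S) : \bar R := mu (uset x).

Definition is_pdf (lambda : {measure set (borelType S) -> \bar R})
    (f : borelType S -> R) : Prop :=
  [/\ measurable_fun setT f, (forall x, (0 <= f x)%R) &
      forall A : set (borelType S), measurable A ->
        mu A = \int[lambda]_(x in A) (f x)%:E].

Definition is_exponential : Prop :=
  forall (x : S) (A : set (borelType S)), measurable A ->
    mu (translate x A) = upf x * mu A.

End Distribution.
End Standard.

Section Sequences.
Local Open Scope ring_scope.
Local Open Scope ereal_scope.
Context d (Omega : measurableType d) (R : realType) (P : probability Omega R).
Context d' (T : measurableType d').
Variable X : nat -> {RV P >-> T}.

Definition mutually_independent : Prop :=
  forall (J : {fset nat}) (A : nat -> set T), (forall i, measurable (A i)) ->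
    P (\bigcap_(i in [set` J]) (X i @^-1` A i)) =
    \prod_(i <- J) P (X i @^-1` A i).

Definition identically_distributed : Prop :=
  forall i (A : set T), measurable A ->
    distribution P (X i) A = distribution P (X 0) A.

Definition iid : Prop := mutually_independent /\ identically_distributed.

(* The product sigma-algebra on the path space. *)
Definition path_measurable : set (set (nat -> T)) :=
  <<s \bigcup_n
        preimage_set_system setT (fun w : nat -> T => w n) measurable >>.

Definition equivalent_processes (U V : nat -> Omega -> T) : Prop :=
  forall E : set (nat -> T), path_measurable E ->
    P [set w | E (U ^~ w)] = P [set w | E (V ^~ w)].

End Sequences.

(* Indices start at 0: [s k], [ladder_time s n], [ladder s n] and
   [partial_product s n] are X_(k+1), N_(n+1) - 1, Y_(n+1) and Z_(n+1). *)
Section Ladder.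
Variable S : ptopMonoidType.
Implicit Type s : nat -> S.

Definition is_later_above s (m : nat) : pred nat :=
  fun k => (m < k)%N && `[< sle (s m) (s k) >].

(* If no later term lies above [s m], the minimum is over an empty set and the
   index is left unchanged.  For an IID sequence whose upper probability
   function is positive this happens on a null event only. *)
Definition next_ladder_time s (m : nat) : nat :=
  match pselect (exists k, is_later_above s m k) with
  | left ex_k => ex_minn ex_k
  | right _ => m
  end.

Fixpoint ladder_time s (n : nat) : nat :=
  if n is n'.+1 then next_ladder_time s (ladder_time s n') else 0.

Definition ladder s (n : nat) : S := s (ladder_time s n).

Definition partial_product s (n : nat) : S := \prod_(i < n.+1) s i.

End Ladder.

Section Processes.
Context d (Omega : measurableType d) (R : realType) (P : probability Omega R).
Variables (S : ptopMonoidType) (X : nat -> {RV P >-> borelType S}).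

Definition ladder_process (n : nat) (w : Omega) : borelType S :=
  ladder (fun k => X k w) n.

Definition partial_product_process (n : nat) (w : Omega) : borelType S :=
  partial_product (fun k => X k w) n.

End Processes.

(* Main.v *)
Require Import Defs.
From HB Require Import structures.
From mathcomp Require Import all_boot all_order all_algebra.
From mathcomp Require Import finmap.
From mathcomp Require Import all_classical all_reals all_analysis.
From mathcomp Require Import measurable_realfun lra.

(** Write mu for the common law and F y for mu (y S).  The argument compares
    the first two coordinates of the two processes on the events
    first coordinate y in A, second coordinate in y K, with K compact.

    For the partial products, left cancellation turns X_0 X_1 in X_0 K into
    X_1 in K, so the event has probability mu A * mu K
    ([partial_product_law]).  For the ladder variables, X_0 is independent of
    the later terms, so that on X_0 = y the second ladder variable is the first
    later term to enter y S.  Summing a geometric series, that term lies in y K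
    with probability mu (y K) / F y ([first_entry_prob]), and integrating over
    y in A gives the probability of the event ([conditioning], [ladder_law]).
    As A is arbitrary, mu (y K) = F y * mu K for mu-almost every y
    ([ae_exponential_on_compact]).

    The exceptional null set depends on K and is removed by continuity.  Let C
    run through compact neighbourhoods shrinking to x.  Then C K decreases to
    x K, and every z K with z in C has, by left invariance, the lambda-measure
    of x K; so z K and x K both fill C K up to a small lambda-measure, hence up
    to a small mu-measure because mu has a density.  Thus y |-> mu (y K) is
    continuous ([translate_measure_continuous]).  Nothing similar is known of F
    yet, so F is eliminated: for compact K and L the identity
    mu (y K) * mu L = mu (y L) * mu K holds almost everywhere between
    continuous functions of y, hence everywhere, mu having full support.
    Letting L increase to S gives mu (x K) = F x * mu K for every x.  Both
    sides are measures in K, and the compact sets are stable under intersection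
    and generate the Borel sets, so the identity holds for all Borel sets
    ([exponential_of_ae]). *)

Set Implicit Arguments.
Unset Strict Implicit.
Unset Printing Implicit Defensive.

Import Order.TTheory GRing.Theory Num.Theory.
Import numFieldNormedType.Exports.

Local Open Scope classical_set_scope.
Local Open Scope ring_scope.
Local Open Scope ereal_scope.

(** * Second countable spaces *)

Section SecondCountable.

(** Indexing a basis by all of [nat], with empty sets at unused indices, spares
    a separate treatment of finite bases. *)
Lemma second_countable_seq_basis (T : topologicalType) :
  @second_countable T -> exists U : nat -> set T,
    (forall n, open (U n)) /\
    (forall x V, nbhs x V -> exists n, U n x /\ U n `<=` V).
Proof.
move=> [B /countable_injP[f finj] [Bopen Bbase]].
exists (fun n => \bigcup_(V in [set V | B V /\ f V = n]) V); split=> [n|x V xV].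
  by apply: bigcup_open => V [/Bopen].
have [W [BW Wx] WV] := Bbase x V xV.
exists (f W); split; first by exists W.
by move=> y [W' [BW' fW'] W'y]; apply: WV; rewrite -(finj W' W) ?inE.
Qed.

(** The Borel sets of a product may exceed the product of the Borel
    sigma-algebras; here an open set is a countable union of open boxes. *)
Lemma open_measurable_prod (T1 T2 : ptopologicalType)
    (A : set (borelType T1 * borelType T2)) :
  @second_countable T1 -> @second_countable T2 ->
  open (A : set (T1 * T2)) -> measurable A.
Proof.
move=> /second_countable_seq_basis[U [Uopen Ubase]].
move=> /second_countable_seq_basis[V [Vopen Vbase]] Aopen.
pose box (ij : nat * nat) : set (borelType T1 * borelType T2) :=
  U ij.1 `*` V ij.2.
have -> : A = \bigcup_(ij in [set ij | box ij `<=` A]) box ij.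
  apply/seteqP; split=> [[x y] Axy|xy [ij ijA]]; last exact: ijA.
  have [[P Q] /= [xP yQ] PQA] : nbhs ((x, y) : T1 * T2) A.
    exact: open_nbhs_nbhs.
  have [i [Uix UiP]] := Ubase x P xP; have [j [Vjy VjQ]] := Vbase y Q yQ.
  exists (i, j) => //= -[a b] /= [Uia Vjb].
  by apply: PQA; split=> /=; [exact: UiP|exact: VjQ].
rewrite bigcup_mkcond; apply: countable_bigcupT_measurable => // ij.
case: ifP => // _; apply: measurableX; apply: sub_sigma_algebra.
  exact: Uopen.
exact: Vopen.
Qed.

Lemma closed_measurable_prod (T1 T2 : ptopologicalType)
    (A : set (borelType T1 * borelType T2)) :
  @second_countable T1 -> @second_countable T2 ->
  closed (A : set (T1 * T2)) -> measurable A.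
Proof.
move=> ct1 ct2 clA; rewrite -(setCK A); apply: measurableC.
apply: open_measurable_prod => //; exact: (closed_openC clA).
Qed.

Lemma closed_measurable (T : ptopologicalType) (A : set (borelType T)) :
  closed (A : set T) -> measurable A.
Proof.
move=> clA; rewrite -(setCK A); apply: measurableC.
by apply: sub_sigma_algebra; exact: closed_openC.
Qed.

Lemma locally_compact_nbhs (T : topologicalType) (x : T) :
  locally_compact [set: T] -> exists2 C : set T, nbhs x C & compact C /\ closed C.
Proof.
move=> lcT; by have [C] := lcT x I; rewrite withinET => xC cC; exists C.
Qed.

(** Select, for each basic open set lying in some compact set, one such compact
    set: local compactness makes the selected ones cover the space. *)
Lemma sigma_compact (T : topologicalType) :
  locally_compact [set: T] -> @second_countable T ->
  exists K : nat -> set T, [/\ forall n, compact (K n),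
    nondecreasing_seq K & \bigcup_n K n = setT].
Proof.
move=> lcT /second_countable_seq_basis[U [Uopen Ubase]].
have /choice[C CP] : forall n, exists C : set T, compact C /\
    ((exists2 D, compact D & U n `<=` D) -> U n `<=` C).
  move=> n; have [[D cD UD]|noD] := pselect (exists2 D, compact D & U n `<=` D).
    by exists D.
  by exists set0; split=> //; exact: compact0.
exists (fun n => \big[setU/set0]_(i < n.+1) C i); split.
- by move=> n; apply: bigsetU_compact => // i _; exact: (CP i).1.
- by move=> m n mn; apply/subsetPset; exact: subset_bigsetU.
- apply/seteqP; split=> // x _.
  have [D xD [cD _]] := locally_compact_nbhs x lcT.
  have [n [Ux UD]] := Ubase x D xD; exists n => //.
  rewrite -bigcup_mkord; exists n => //=.
  by apply: (CP n).2 => //; exists D.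
Qed.

(** Inside a compact neighbourhood [L], closures of basic neighbourhoods are
    arbitrarily small because a locally compact Hausdorff space is regular. *)
Lemma compact_nbhs_basis (T : topologicalType) (x : T) :
  hausdorff_space T -> locally_compact [set: T] -> @second_countable T ->
  exists C : nat -> set T, [/\ forall n, compact (C n), forall n, nbhs x (C n),
    nonincreasing_seq C &
    forall V, nbhs x V -> exists n, C n `<=` V].
Proof.
move=> hT lcT /second_countable_seq_basis[U [Uopen Ubase]].
have [L xL [cL clL]] := locally_compact_nbhs x lcT.
pose D i := if `[< U i x >] then closure (U i) else setT.
pose C n := L `&` \bigcap_(i < n) D i.
have xD i : nbhs x (D i).
  rewrite /D; case: asboolP => [Ux|_]; last exact: filterT.
  by apply: filterS (open_nbhs_nbhs _); [exact: subset_closure|split].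
exists C; split.
- move=> n; apply: subclosed_compact cL _; last by move=> y [].
  apply: closedI => //; apply: closed_bigI => i _; rewrite /D.
  by case: asboolP => _; [exact: closed_closure|exact: closedT].
- move=> n; apply: filterI => //; rewrite bigcap_mkord.
  by apply: big_ind => //; [exact: filterT|exact: filterI].
- move=> m n mn; apply/subsetPset => y [Ly Dy]; split=> // i /= im.
  by apply: Dy; exact: leq_trans mn.
- move=> V xV; have [W xW WV] := compact_regular hT cL xL xV.
  have [i [Uix UiW]] := Ubase x W xW; exists i.+1 => y [_ Dy].
  have := Dy i (ltnSn i); rewrite /D; case: asboolP => // _ yU.
  by apply: WV; exact: closureS yU.
Qed.

End SecondCountable.

(** * Topology of a positive semigroup *)

Section PositiveSemigroupTopology.
Variable S : ptopMonoidType.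
Implicit Types (x y z t : S) (K : set S).
Hypothesis posS : positive_semigroup S.
Hypothesis sle_closed : closed [set xy : S * S | sle xy.1 xy.2].
Hypothesis mul_continuous : continuous (fun xy : S * S => (xy.1 * xy.2)%g).

Lemma sle_refl x : sle x x.
Proof. by exists 1%g; rewrite mulg1. Qed.

Lemma sle_anti x y : sle x y -> sle y x -> x = y.
Proof.
move=> [t xt] [s ys].
have ts1 : (t * s = 1)%g.
  by apply: (left_cancel posS (x := x)); rewrite mulgA xt ys mulg1.
have st1 : (s * t = 1)%g.
  by apply: (left_cancel posS (x := t)); rewrite mulgA ts1 mul1g mulg1.
by rewrite -xt (no_inverse posS ts1 st1) mulg1.
Qed.

(** If [p] and [q] cannot be separated then [(p, q)] is a limit of diagonal
    points, so the closed order contains both [(p, q)] and [(q, p)], and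
    antisymmetry applies. *)
Lemma sle_hausdorff : hausdorff_space S.
Proof.
move=> p q pq.
have diag A : (forall z, A (z, z)) -> closed A -> A (p, q).
  move=> Adiag; apply => B [[U V] /= [pU qV] UVB].
  have [z [Uz Vz]] := pq _ _ pU qV.
  by exists (z, z); split=> //; apply: UVB.
apply: sle_anti.
  by apply: (diag [set xy | sle xy.1 xy.2]) => // z; exact: sle_refl.
have swapc : continuous (fun xy : S * S => (xy.2, xy.1)).
  by move=> xy; apply: cvg_pair; [exact: cvg_snd|exact: cvg_fst].
apply: (diag [set xy | sle xy.2 xy.1]) => [z|]; first exact: sle_refl.
exact: (closed_comp (fun xy _ => swapc xy) sle_closed).
Qed.

Lemma translate_compact x K : compact K -> compact (translate x K).
Proof.
move=> cK; apply: continuous_compact => //.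
apply: continuous_subspaceT => y.
apply: (@continuous_comp _ _ _ (fun a => (x, a)) (fun xy => (xy.1 * xy.2)%g)).
  by apply: cvg_pair; [exact: cvg_cst|exact: cvg_id].
exact: mul_continuous.
Qed.

Lemma mul_set_compact C K : compact C -> compact K ->
  compact [set (z * k)%g | z in C & k in K].
Proof.
move=> cC cK.
have -> : [set (z * k)%g | z in C & k in K] =
    (fun xy : S * S => (xy.1 * xy.2)%g) @` (C `*` K).
  apply/seteqP; split=> [_ [z Cz [k Kk <-]]|_ [[z k] [Cz Kk] <-]].
    by exists (z, k).
  by exists z => //; exists k.
apply: continuous_compact; last exact: compact_setX.
exact: continuous_subspaceT.
Qed.

(** Projecting the closed relation [y * k = z] along the compact factor keeps
    it closed; this is what makes [z K] vary semicontinuously with [z]. *)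
Lemma translate_graph_closed K : compact K ->
  closed [set yz : S * S | translate yz.1 K yz.2].
Proof.
move=> /compact_near_coveringP cK.
rewrite -openC openE => -[y z] /= yzK.
pose P (ab : S * S) (k : S) := (ab.1 * k)%g <> ab.2.
have : \forall ab \near (y, z), K `<=` P ab.
  apply: (cK _ (nbhs (y, z)) P) => k Kk.
  have yk_z : (y * k)%g != z.
    by apply/eqP => ykz; apply: yzK; exists k.
  have := sle_hausdorff; rewrite open_hausdorff => /(_ _ _ yk_z).
  move=> [[U V] /= []]; rewrite !inE => Uyk Vz [oU oV UV0].
  have {}UV0 w : U w -> V w -> False.
    move=> Uw Vw; have : (U `&` V) w by [].
    by rewrite UV0.
  have [[A B] /= [yA kB] AB] :=
    @mul_continuous (y, k) _ (open_nbhs_nbhs (conj oU Uyk)).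
  exists (B, A `*` V) => /=.
    by split=> //; exists (A, V) => //=; split=> //; exact: open_nbhs_nbhs.
  move=> [k' [a b]] /= [Bk' [Aa Vb]] ak'b.
  apply: (UV0 b) => //; rewrite -[b]ak'b; exact: (AB (a, k')).
by apply: filterS => -[a b] KP [k Kk akb]; exact: (KP k).
Qed.

End PositiveSemigroupTopology.
(** * Measures of translates of a compact set *)

Section AbsoluteContinuity.
Context d (T : measurableType d) (R : realType).
Variables (mu : {finite_measure set T -> \bar R})
  (lambda : {measure set T -> \bar R}).

(** Were it false, some sets of [mu]-measure at least [e] would have summable
    [lambda]-measures.  By Borel-Cantelli their limsup is [lambda]-null, but
    its [mu]-measure is at least [e] since [mu] is finite. *)
Lemma null_dominates_eps_delta :
  (forall A, measurable A -> lambda A = 0 -> mu A = 0) ->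
  forall e : R, (0 < e)%R -> exists2 del : R, (0 < del)%R &
    forall A, measurable A -> lambda A < del%:E -> mu A < e%:E.
Proof.
move=> mul e e0; apply: contrapT => nodel.
have /choice[A AP] : forall n : nat, exists A : set T,
    [/\ measurable A, lambda A < (1 / (2 ^ n.+1)%:R)%:E & e%:E <= mu A].
  move=> n; apply: contrapT => noA; apply: nodel.
  (* These bounds sum to 1. *)
  exists (1 / (2 ^ n.+1)%:R)%R => [|A mA lA]; first by rewrite divr_gt0// ltr0n expn_gt0.
  by rewrite ltNge; apply/negP => eA; apply: noA; exists A.
have mA n : measurable (A n) by have [] := AP n.
have sumA : \sum_(n <oo) lambda (A n) < +oo.
  apply: le_lt_trans (ltry 1).
  apply: le_trans (epsilon_trick0 xpredT ler01).
  by apply: lee_nneseries => // n _; have [_ /ltW + _] := AP n.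
have limsup0 : mu (lim_sup_set A) = 0.
  apply: mul; last exact: lim_sup_set_cvg0.
  by apply: bigcap_measurable => // k _; exact: bigcup_measurable.
have : e%:E <= mu (lim_sup_set A).
  have := lim_sup_set_cvg mu A mA.
  rewrite -ge0_fin_numE// fin_num_measure; last exact: bigcup_measurable.
  move=> /(_ isT) cvgA; rewrite -(cvg_lim _ cvgA)//; apply: lime_ge.
    by apply/cvg_ex; eexists; exact: cvgA.
  apply: nearW => n; have [_ _ eA] := AP n; apply: le_trans eA _.
  apply: le_measure; rewrite ?inE//; first exact: bigcup_measurable.
  by move=> t At; exists n => /=.
by rewrite limsup0 lee_fin leNgt e0.
Qed.

End AbsoluteContinuity.

Lemma measureD_subset d (T : measurableType d) (R : realType)
    (nu : {measure set T -> \bar R}) (A B : set T) :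
  measurable A -> measurable B -> B `<=` A -> nu A < +oo ->
  nu (A `\` B) = nu A - nu B.
Proof. by move=> mA mB BA Aoo; rewrite measureD// setIidr. Qed.

Section TranslateContinuity.
Variables (R : realType) (S : ptopMonoidType).
Variables (lambda : {measure set (borelType S) -> \bar R})
  (mu : {finite_measure set (borelType S) -> \bar R}).
Hypothesis hS : standard_positive_semigroup lambda.
Hypothesis mu_lambda :
  forall A : set (borelType S), measurable A -> lambda A = 0 -> mu A = 0.
Implicit Types (x y z : S) (K : set S).

Lemma std_hausdorff : hausdorff_space S.
Proof. exact: sle_hausdorff (std_positive hS) (std_closed_order hS). Qed.

Lemma compact_measurable K : compact K -> measurable (K : set (borelType S)).
Proof.
by move=> cK; apply: closed_measurable; exact: compact_closed std_hausdorff cK.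
Qed.

Lemma std_translate_compact x K : compact K -> compact (translate x K).
Proof. exact/translate_compact/(std_continuous_mul hS). Qed.

Lemma std_translate_graph_closed K : compact K ->
  closed [set yz : S * S | translate yz.1 K yz.2].
Proof.
exact: translate_graph_closed (std_positive hS) (std_closed_order hS)
  (std_continuous_mul hS) _.
Qed.

(** A point [w] outside [x K] stays outside [z K] for all [z] near [x], the
    graph of [z |-> z K] being closed; hence [C n * K] shrinks to [x K]. *)
Lemma compact_near_translate x K : compact K ->
  exists C : nat -> set S, [/\ forall n, nbhs x (C n),
    forall n, compact [set (z * k)%g | z in C n & k in K],
    nonincreasing_seq (fun n => [set (z * k)%g | z in C n & k in K]) &
    \bigcap_n [set (z * k)%g | z in C n & k in K] = translate x K].
Proof.
move=> cK; have [C [cC xC niC Cbase]] := compact_nbhs_basis x std_hausdorff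
  (std_locally_compact hS) (std_second_countable hS).
exists C; split=> //.
- by move=> n; exact: (mul_set_compact (std_continuous_mul hS)).
- move=> m n mn; apply/subsetPset => _ [z Cz [k Kk <-]].
  have CC : C n `<=` C m by have := niC _ _ mn; rewrite subsetEset.
  by exists z; [exact: CC|exists k].
- apply/seteqP; split=> [w CKw|_ [k Kk <-] n _]; last first.
    by exists x; [exact: nbhs_singleton|exists k].
  apply: contrapT => xKw.
  have /closed_openC := std_translate_graph_closed cK.
  rewrite openE => /(_ (x, w) xKw)[[U V] /= [xU wV] UV].
  have [n CU] := Cbase U xU; have [z Cz [k Kk zk]] := CKw n I.
  have /= := UV (z, w) (conj (CU _ Cz) (nbhs_singleton wV)).
  by apply; exists k.
Qed.

(** Semicontinuity of [z |-> z K] alone gives only the upper bound.  The lower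
    one comes from left invariance: [z K] cannot be much smaller than
    [C n * K], since it has the same [lambda]-measure as [x K]. *)
Lemma translate_measure_continuous K : compact K ->
  continuous (fun y : S => fine (mu (translate y K)) : R^o).
Proof.
move=> cK x; have [C [xC cCK niCK CKx]] := compact_near_translate x cK.
pose T n : set (borelType S) := [set (z * k)%g | z in C n & k in K].
have mT n : measurable (T n) by exact: (compact_measurable (cCK n)).
have mtr z : measurable (translate z K : set (borelType S)).
  exact: (compact_measurable (std_translate_compact cK)).
have lK : lambda K \is a fin_num.
  by rewrite ge0_fin_numE//; exact: (std_finite_compact hS cK).
have lT : lambda (T n) @[n --> \oo] --> lambda K.
  rewrite -(std_left_invariant hS x (compact_measurable cK)).
  have -> : translate x K = \bigcap_n T n :> set (borelType S) by rewrite CKx.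
  apply: nonincreasing_cvg_mu => //.
    exact: (std_finite_compact hS (cCK 0%N)).
  by rewrite /T CKx; exact: mtr.
apply/cvgrPdist_lt => e e0.
have [del del0 mudel] := null_dominates_eps_delta mu_lambda e0.
have [n lTn] : exists n, lambda (T n) < lambda K + del%:E.
  have : \forall n \near \oo, lambda (T n) < lambda K + del%:E.
    by apply: (lT [set u | u < _]); apply: open_ereal_lt'; rewrite lteDl// lte_fin.
  by move=> [n _ /(_ n (leqnn n))]; exists n.
have TnC z : C n z -> translate z K `<=` T n.
  by move=> Cz _ [k Kk <-]; exists z => //; exists k.
have muT z : C n z ->
    (fine (mu (T n)) - e < fine (mu (translate z K)) <= fine (mu (T n)))%R.
  move=> Cz; have /= : mu (T n `\` translate z K) < e%:E.
    apply: mudel; first by apply: measurableD.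
    rewrite (measureD_subset (mT n) (mtr z) (TnC z Cz)); last first.
      exact: (std_finite_compact hS (cCK n)).
    by rewrite (std_left_invariant hS z (compact_measurable cK)) lteBlDl.
  rewrite (measureD_subset (mT n) (mtr z) (TnC z Cz)); last first.
    by rewrite -ge0_fin_numE// fin_num_measure.
  have fT : mu (T n) \is a fin_num by exact: fin_num_measure.
  have ftr : mu (translate z K) \is a fin_num by exact: fin_num_measure.
  move=> Te; have {}Te : (fine (mu (T n)) - fine (mu (translate z K)) < e)%R.
    by rewrite -lte_fin EFinB !fineK.
  rewrite fine_le// ?andbT; first by rewrite ltrBlDr -ltrBlDl.
  by apply: le_measure; rewrite ?inE//; exact: TnC.
apply: filterS (xC n) => z Cz.
have /andP[x1 x2] := muT x (nbhs_singleton (xC n)).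
have /andP[z1 z2] := muT z Cz.
by rewrite ltr_distl; apply/andP; split; lra.
Qed.

End TranslateContinuity.
(** * From almost every translate of compacts to exponential laws *)

Section ExponentialFromCompacts.
Variables (R : realType) (S : ptopMonoidType).
Variables (lambda : {measure set (borelType S) -> \bar R})
  (mu : probability (borelType S) R).
Hypothesis hS : standard_positive_semigroup lambda.
Implicit Types (x y z : S) (K L : set S).

Lemma translateT x : translate x setT = uset x.
Proof.
by apply/seteqP; split=> [_ [t _ <-]|_ [t <-]]; exists t.
Qed.

Lemma translate_bigcup x (A : nat -> set S) :
  translate x (\bigcup_n A n) = \bigcup_n translate x (A n).
Proof.
apply/seteqP; split=> [_ [t [n _ At] <-]|_ [n _ [t At <-]]].
  by exists n => //; exists t.
by exists t => //; exists n.
Qed.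

Lemma std_mulgI x : injective (fun t => (x * t)%g).
Proof. by move=> t s; exact: (left_cancel (std_positive hS)). Qed.

Lemma translateC x (A : set S) : translate x (~` A) = uset x `\` translate x A.
Proof.
rewrite -translateT; apply/seteqP; split=> [_ [t At <-]|_ [[t _ <-]] xA].
  by split; [exists t|move=> [s As /std_mulgI st]; apply: At; rewrite -st].
by exists t => // At; apply: xA; exists t.
Qed.

Lemma std_sigma_compact : exists K : nat -> set S, [/\ forall n, compact (K n),
    nondecreasing_seq K & \bigcup_n K n = setT].
Proof.
exact: sigma_compact (std_locally_compact hS) (std_second_countable hS).
Qed.

Lemma std_compactI K (C : set S) : compact K -> closed C -> compact (C `&` K).
Proof.
move=> cK cC; apply: (subclosed_compact _ cK) => //.
by apply: closedI => //; exact: compact_closed (std_hausdorff hS) cK.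
Qed.

(** Translations map compact sets to compact sets; through such unions they map
    closed sets to Borel sets. *)
Lemma closed_bigcup_compact (C : set S) : closed C ->
  exists2 K : nat -> set S, forall n, compact (K n) & C = \bigcup_n K n.
Proof.
move=> cC; have [K [cK _ KT]] := std_sigma_compact.
exists (fun n => C `&` K n) => [n|]; first exact: std_compactI.
by rewrite -setI_bigcupr KT setIT.
Qed.

Lemma measurable_uset x : measurable (uset x : set (borelType S)).
Proof.
apply: closed_measurable.
have xc : continuous (fun y : S => (x, y)).
  by move=> y; apply: cvg_pair; [exact: cvg_cst|exact: cvg_id].
exact: (closed_comp (fun y _ => xc y) (std_closed_order hS)).
Qed.

(** The sets with a measurable translate form a sigma-algebra, because
    cancellation makes translation injective and its range [uset x] is
    closed. *)
Lemma measurable_translate x (A : set (borelType S)) :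
  measurable A -> measurable (translate x A : set (borelType S)).
Proof.
move: A; apply: smallest_sub => [|U oU] /=.
  split=> [|A mA|A mA].
  - by rewrite /translate image_set0.
  - by rewrite setTD translateC; apply: measurableD => //; exact: measurable_uset.
  - by rewrite translate_bigcup; exact: bigcupT_measurable.
have [K cK UK] := closed_bigcup_compact (open_closedC oU).
have -> : translate x U = uset x `\` translate x (~` U).
  by rewrite -translateC setCK.
apply: measurableD; first exact: measurable_uset.
rewrite UK translate_bigcup; apply: bigcupT_measurable => n.
exact: compact_measurable hS _ (std_translate_compact hS (cK n)).
Qed.

Lemma borel_sigma_compact :
  (@measurable _ (borelType S)) `<=` <<s (compact : set (set S)) >>.
Proof.
apply: smallest_sub; first exact: smallest_sigma_algebra.
move=> U oU; have [K cK UK] := closed_bigcup_compact (open_closedC oU).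
rewrite -(setCK U) UK.
have [_ sC sU] := smallest_sigma_algebra setT (compact : set (set S)).
rewrite -setTD; apply: sC; apply: sU => n; exact: sub_sigma_algebra.
Qed.

Definition translated_measure x (A : set (borelType S)) : \bar R :=
  mu (translate x A).

Section TranslatedMeasure.
Variable x : S.

Let tm0 : translated_measure x set0 = 0.
Proof. by rewrite /translated_measure /translate image_set0 measure0. Qed.

Let tm_ge0 A : 0 <= translated_measure x A.
Proof. exact: measure_ge0. Qed.

Let tm_sigma_additive : semi_sigma_additive (translated_measure x).
Proof.
move=> A mA tA mUA; rewrite /translated_measure translate_bigcup.
apply: measure_semi_sigma_additive.
- by move=> n; exact: measurable_translate.
- apply/trivIsetP => i j _ _ ij; apply/seteqP; split=> // _ [[t At <-]].
  move=> [s As /std_mulgI st].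
  have /trivIsetP/(_ i j I I ij) AA := tA.
  suff : (A i `&` A j) t by rewrite AA.
  by split=> //; rewrite -st.
- by rewrite -translate_bigcup; exact: measurable_translate.
Qed.

HB.instance Definition _ := isMeasure.Build _ _ _ (translated_measure x)
  tm0 tm_ge0 tm_sigma_additive.

End TranslatedMeasure.

Lemma exponential_of_compacts :
  (forall x K, compact K -> mu (translate x K) = upf mu x * mu K) ->
  is_exponential mu.
Proof.
move=> muK x A mA.
have fF : upf mu x \is a fin_num.
  by apply: fin_num_measure; exact: measurable_uset.
pose c : {nonneg R} := NngNum (fine_ge0 (measure_ge0 mu (uset x))).
have [K [cK _ KT]] := std_sigma_compact.
rewrite -(fineK fF).
apply: (@g_sigma_algebra_measure_unique _ R (borelType S)
  (compact : set (set S)) _ K cK KT (translated_measure x) (mscale c mu)).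
- by move=> B cB; exact: (compact_measurable hS cB).
- move=> B C cB cC; apply: std_compactI => //.
  exact: compact_closed (std_hausdorff hS) cB.
- move=> B cB; transitivity ((fine (upf mu x))%:E * mu B) => //.
  by rewrite fineK//; exact: muK.
- move=> k; rewrite -ge0_fin_numE//; apply: (fin_num_measure mu).
  by apply: measurable_translate; exact: (compact_measurable hS (cK k)).
- exact: borel_sigma_compact.
Qed.

(** The hypothesis has a null set for each [K] and says nothing of the
    regularity of [upf mu].  Eliminating [upf mu] between two compact sets
    leaves an identity between continuous functions. *)
Lemma exponential_of_ae :
  (forall A : set (borelType S), measurable A -> lambda A = 0 -> mu A = 0) ->
  measure_support mu = [set: S] ->
  (forall K, compact K ->
    {ae mu, forall y, mu (translate y K) = upf mu y * mu K}) ->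
  is_exponential mu.
Proof.
move=> mu_lambda supp aeK; apply: exponential_of_compacts => x K cK.
have fin A : measurable A -> mu A \is a fin_num by exact: fin_num_measure.
have mK L : compact L -> measurable (L : set (borelType S)).
  by move=> cL; exact: (compact_measurable hS cL).
have mxK L : compact L -> measurable (translate x L : set (borelType S)).
  by move=> cL; apply: mK; exact: (std_translate_compact hS).
have cross L : compact L ->
    mu (translate x K) * mu L = mu (translate x L) * mu K.
  move=> cL; pose g y := (fine (mu (translate y K)) * fine (mu L) -
    fine (mu (translate y L)) * fine (mu K))%R.
  have g_cont : continuous (g : S -> R^o).
    move=> y; apply: cvgB; apply: cvgM; try exact: cvg_cst.
      exact: (translate_measure_continuous hS mu_lambda cK).
    exact: (translate_measure_continuous hS mu_lambda cL).
  have [gx0|gx0] := eqVneq (g x) 0%R.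
    have := gx0; rewrite /g => /eqP; rewrite subr_eq0 => /eqP e.
    by rewrite -(fineK (fin _ (mxK _ cK))) -(fineK (fin _ (mxK _ cL)))
      -(fineK (fin _ (mK _ cK))) -(fineK (fin _ (mK _ cL))) -!EFinM e.
  pose U := [set y | g y != 0%R].
  have oU : open U.
    have -> : U = g @^-1` (~` [set 0%R]) by apply/seteqP; split=> y /= /eqP.
    by apply: open_comp => //; apply: closed_openC; exact: closed_eq.
  have muU : mu U = 0.
    apply: measure_negligible; first exact: sub_sigma_algebra.
    have KL : mu.-negligible (~` [set y |
        mu (translate y K) = upf mu y * mu K /\
        mu (translate y L) = upf mu y * mu L]).
      exact: (@filterI _ _ (ae_filter_ringOfSetsType mu) _ _ (aeK K cK) (aeK L cL)).
    apply: negligibleS KL => y Uy [eK eL]; move: Uy.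
    rewrite /U /g /= eK eL => /eqP; apply.
    have mF : upf mu y \is a fin_num by apply: fin; exact: measurable_uset.
    rewrite (fineM mF (fin _ (mK _ cK))) (fineM mF (fin _ (mK _ cL))).
    by rewrite mulrAC subrr.
  have := supp; move/seteqP => [_ /(_ x I)] /(_ U oU gx0).
  by rewrite muU ltxx.
(* [upf mu x] comes back as the limit of [mu (translate x (L n))]. *)
have [L [cL ndL LT]] := std_sigma_compact.
have muL : mu (L n) @[n --> \oo] --> (1 : \bar R).
  rewrite -(probability_setT mu) -LT; apply: nondecreasing_cvg_mu => //.
    by move=> n; exact: mK.
  by rewrite LT.
have muxL : mu (translate x (L n)) @[n --> \oo] --> upf mu x.
  rewrite /upf -translateT -LT translate_bigcup.
  apply: nondecreasing_cvg_mu => //.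
  - by move=> n; exact: mxK.
  - by apply: bigcupT_measurable => n; exact: mxK.
  - move=> m n mn; apply/subsetPset => _ [t Lt <-]; exists t => //.
    by have := ndL _ _ mn; rewrite subsetEset; exact.
have l1 : mu (translate x K) * mu (L n) @[n --> \oo] --> mu (translate x K) * 1.
  by apply: cvgeZl => //; exact: fin (mxK _ cK).
have l2 : mu (translate x (L n)) * mu K @[n --> \oo] --> upf mu x * mu K.
  by apply: cvgeZr => //; exact: fin (mK _ cK).
rewrite -[LHS]mule1 -(cvg_lim _ l1)// -(cvg_lim _ l2)//.
by apply: congr_lim; apply/funext => n; exact: cross.
Qed.

End ExponentialFromCompacts.
(** * Conditioning on the first term of an IID sequence *)

Section IndependentSequences.
Context d (Omega : measurableType d) (R : realType) (P : probability Omega R).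
Context d' (T : measurableType d').
Implicit Types (A C D : set T) (B : nat -> set T).

Section Conditioning.
Variables (U : {RV P >-> T}) (G : set (set Omega)).
Hypothesis mG : G `<=` measurable.
Hypothesis indG : forall A H, measurable A -> <<s G >> H ->
  P (U @^-1` A `&` H) = P (U @^-1` A) * P H.

(** The sample space with the coarser sigma-algebra: on [T * OmegaG] the law of
    [w |-> (U w, w)] is a product measure, which would be false on
    [T * Omega]. *)
Let OmegaG := g_sigma_algebraType G.

Let coarsen (w : Omega) : OmegaG := w.

Let measurable_coarsen : measurable_fun setT coarsen.
Proof.
move=> _ H mH; rewrite setTI.
exact: (smallest_sub (@sigma_algebra_measurable _ Omega) mG) mH.
Qed.

HB.instance Definition _ :=
  isMeasurableFun.Build _ _ _ _ coarsen measurable_coarsen.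

Let graph (w : Omega) : T * OmegaG := (U w, coarsen w).

Let measurable_graph : measurable_fun setT graph.
Proof. exact: measurable_fun_pair. Qed.

HB.instance Definition _ :=
  isMeasurableFun.Build _ _ _ _ graph measurable_graph.

Lemma measurable_graph_preimage (E : set (T * OmegaG)) : measurable E ->
  measurable [set w | E (U w, w)].
Proof. by move=> mE; have := measurable_graph measurableT mE; rewrite setTI. Qed.

(** By independence [w |-> (U w, w)] has a product law, so this is Tonelli's
    theorem for an indicator function. *)
Lemma conditioning (E : set (T * OmegaG)) : measurable E ->
  P [set w | E (U w, w)] =
  \int[distribution P U]_y P [set w | E (y, w)].
Proof.
move=> mE.
transitivity ((distribution P U \x distribution P coarsen) E).
  by apply/esym; apply: (product_measure_unique (m' := distribution P graph)).
by apply: eq_integral => y _; congr (P _); apply/seteqP; split=> w /=;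
  rewrite /xsection/= inE.
Qed.

Lemma measurable_section (E : set (T * OmegaG)) : measurable E ->
  measurable_fun [set: T] ((fun y => P [set w | E (y, w)]) : T -> \bar R).
Proof.
move=> mE; have := measurable_fun_xsection (distribution P coarsen) mE.
apply: eq_measurable_fun => y _ /=; congr (P _); apply/seteqP.
by split=> w /=; rewrite /xsection/= inE.
Qed.

End Conditioning.

Variable X : nat -> {RV P >-> T}.
Hypothesis iidX : iid X.

Lemma measurable_preimage i A : measurable A -> measurable (X i @^-1` A).
Proof. by move=> mA; rewrite -[_ @^-1` _]setTI; exact: measurable_funP. Qed.

Lemma independent_cylinder n B : (forall i, measurable (B i)) ->
  P (\bigcap_(i < n) X i @^-1` B i) = \prod_(i < n) P (X i @^-1` B i).
Proof.
move=> mB; have := iidX.1 [fset i | i in iota 0 n]%fset B mB.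
have -> : [set` [fset i | i in iota 0 n]%fset] = `I_n.
  apply/seteqP; split=> i /=; first by move/imfsetP=> [j /=]; rewrite mem_iota => ? ->.
  by move=> i_n; apply/imfsetP; exists i => //=; rewrite mem_iota.
move=> ->; rewrite -(big_mkord xpredT (fun i => P (X i @^-1` B i))).
rewrite /index_iota subn0; apply: perm_big.
apply: uniq_perm; [exact: fset_uniq|exact: iota_uniq|move=> i].
by apply/imfsetP/idP => [[j ? ->]//|i_n]; exists i.
Qed.

Lemma identical_distribution i A : measurable A ->
  P (X i @^-1` A) = distribution P (X 0%N) A.
Proof. exact: iidX.2. Qed.

Definition future_cylinders : set (set Omega) :=
  [set H | exists n B, (forall i, measurable (B i)) /\
     H = \bigcap_(i < n) X i.+1 @^-1` B i].

Lemma future_cylinders_measurable : future_cylinders `<=` measurable.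
Proof.
move=> _ [n [B [mB ->]]]; apply: bigcap_measurableType => // i _.
exact: measurable_preimage.
Qed.

Lemma future_cylinders_setI : setI_closed future_cylinders.
Proof.
move=> _ _ [n [B [mB ->]]] [m [C [mC ->]]].
exists (maxn n m), (fun i => (if (i < n)%N then B i else setT) `&`
  (if (i < m)%N then C i else setT)); split.
  by move=> i; apply: measurableI; case: ifP.
apply/seteqP; split=> w.
  by move=> [Bw Cw] i _; split; case: ifP => // im; [exact: Bw|exact: Cw].
move=> BCw; split=> i /= im.
  by have [] := BCw i (leq_trans im (leq_maxl _ _)); rewrite im.
by have [_] := BCw i (leq_trans im (leq_maxr _ _)); rewrite im.
Qed.

(** Both sides are finite measures in [H] that agree on cylinders, a family
    stable under intersection. *)
Lemma independent_future A H : measurable A -> <<s future_cylinders >> H ->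
  P (X 0%N @^-1` A `&` H) = P (X 0%N @^-1` A) * P H.
Proof.
move=> mA sH; have mXA := measurable_preimage 0 mA.
have fXA : P (X 0%N @^-1` A) \is a fin_num by exact: fin_num_measure.
pose c : {nonneg R} := NngNum (fine_ge0 (measure_ge0 P (X 0%N @^-1` A))).
rewrite setIC -(fineK fXA).
have cT : \bigcup_(k : nat) [set: Omega] = [set: Omega].
  by apply/seteqP; split=> // w _; exists 0%N.
apply: (@g_sigma_algebra_measure_unique _ R Omega future_cylinders _
  (fun=> setT) _ cT (mrestr P mXA) (mscale c P)) => //.
- exact: future_cylinders_measurable.
- by move=> _; exists 0%N, (fun=> setT); split=> //; rewrite bigcap_mkord big_ord0.
- exact: future_cylinders_setI.
- move=> _ [n [B [mB ->]]].
  transitivity ((fine (P (X 0%N @^-1` A)))%:E *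
    P (\bigcap_(i < n) X i.+1 @^-1` B i)) => //.
  transitivity (P (X 0%N @^-1` A `&` \bigcap_(i < n) X i.+1 @^-1` B i)).
    by rewrite setIC.
  rewrite fineK//.
  (* Both events are cylinders over the sequence from index 0, constrained by
     [A], respectively by [setT], there. *)
  pose B' i := if i is j.+1 then B j else A.
  have mB' i : measurable (B' i) by case: i.
  pose B'' i := if i is j.+1 then B j else setT.
  have mB'' i : measurable (B'' i) by case: i => [|i]; [exact: measurableT|exact: mB].
  have -> : X 0%N @^-1` A `&` \bigcap_(i < n) X i.+1 @^-1` B i =
      \bigcap_(i < n.+1) X i @^-1` B' i.
    apply/seteqP; split=> [w [Aw Bw] [|i] //= i_n|w Bw]; first exact: Bw.
    by split=> [|i i_n]; [exact: (Bw 0%N)|exact: (Bw i.+1)].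
  have -> : \bigcap_(i < n) X i.+1 @^-1` B i =
      \bigcap_(i < n.+1) X i @^-1` B'' i.
    apply/seteqP; split=> [w Bw [|i] //= i_n|w Bw i i_n]; first exact: Bw.
    exact: (Bw i.+1).
  rewrite !independent_cylinder// !big_ord_recl/=; congr (_ * _).
  by rewrite preimage_setT probability_setT mul1e.
- by move=> _; rewrite -ge0_fin_numE//; apply: (fin_num_measure P); exact: measurableI.
Qed.

Lemma sub_future i A : measurable A ->
  <<s future_cylinders >> (X i.+1 @^-1` A).
Proof.
move=> mA; apply: sub_sigma_algebra.
exists i.+1, (fun j => if j == i then A else setT); split.
  by move=> j; case: ifP.
apply/seteqP; split=> [w Aw j _ /=|w Aw]; first by case: eqP => // ->.
by have /= := Aw i (ltnSn i); rewrite eqxx.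
Qed.

(** The index 0 term is left out: it plays the part of the starting point. *)
Definition first_entry C D : set Omega :=
  [set w | exists k, (forall j, (j < k)%N -> ~ C (X j.+1 w)) /\ D (X k.+1 w)].

(** The first entry into [C] falls in [D] at time [k] with probability
    [(1 - mu C) ^+ k * mu D]; the sum over [k] is [mu D / mu C].  The product
    form avoids a division in [\bar R]. *)
Lemma first_entry_prob C D : measurable C -> measurable D -> D `<=` C ->
  0 < distribution P (X 0%N) C ->
  P (first_entry C D) * distribution P (X 0%N) C = distribution P (X 0%N) D.
Proof.
move=> mC mD DC C0; set mu := distribution P (X 0%N) in C0 *.
(* [F k] is the event that the first entry occurs at time [k] and in [D]. *)
pose F k := [set w | (forall j, (j < k)%N -> ~ C (X j.+1 w)) /\ D (X k.+1 w)].
pose B k i := if i is j.+1 then (if (j < k)%N then ~` C else D) else setT.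
have mB k i : measurable (B k i).
  by case: i => [|i] /=; [exact: measurableT|case: ifP => // _; exact: measurableC].
have FB k : F k = \bigcap_(i < k.+2) X i @^-1` B k i.
  apply/seteqP; split=> [w [Cw Dw] [|j] //= jk|w Bw].
    case: ifP => [j_k|kj]; first exact: Cw.
    suff -> : j = k by [].
    by apply/eqP; rewrite eqn_leq [(k <= j)%N]leqNgt kj andbT; exact: jk.
  split=> [j jk|]; last by have /= := Bw k.+1 (ltnSn _); rewrite ltnn.
  by have /= := Bw j.+1 (ltnW jk : (j.+1 < k.+2)%N); rewrite jk.
have mF k : measurable (F k).
  by rewrite FB; apply: bigcap_measurableType => // i _; exact: measurable_preimage.
have mu_fin A : measurable A -> mu A \is a fin_num by exact: fin_num_measure.
set c := fine (mu C); set e := fine (mu D).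
have muC : mu C = c%:E by rewrite fineK ?mu_fin.
have muD : mu D = e%:E by rewrite fineK ?mu_fin.
have c0 : (0 < c)%R by rewrite -lte_fin -muC.
have c1 : (c <= 1)%R by rewrite -lee_fin -muC; exact: probability_le1.
have PC j : P (X j @^-1` ~` C) = (1 - c)%:E.
  rewrite identical_distribution; last exact: measurableC.
  by rewrite probability_setC// [X in _ - X]muC.
have PF k : P (F k) = ((1 - c) ^+ k * e)%:E.
  rewrite FB independent_cylinder// big_ord_recl /= preimage_setT.
  rewrite probability_setT mul1e big_ord_recr /= ltnn identical_distribution//.
  rewrite -/mu muD EFinM; congr (_ * _).
  under eq_bigr => i _.
    rewrite ltn_ord PC; over.
  by rewrite prodEFin prodr_const card_ord.
have tF : trivIset setT F.
  apply/trivIsetP => i j _ _ ij; wlog ltij : i j ij / (i < j)%N.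
    move=> W; have [/W->//|ji|/eqP] := ltngtP i j; last by rewrite (negbTE ij).
    by rewrite setIC W// eq_sym.
  apply/seteqP; split=> // w [[_ Dw] [Cw _]].
  exact: (Cw i ltij (DC _ Dw)).
have feF : first_entry C D = \bigcup_k F k.
  by apply/seteqP; split=> [w [k Fw]|w [k _ Fw]]; exists k.
have lim1 := @measure_semi_sigma_additive _ _ _ P F mF tF (bigcupT_measurable F mF).
have lim2 : (fun n => \sum_(0 <= k < n) P (F k)) @ \oo --> (e / c)%:E.
  have -> : (fun n => \sum_(0 <= k < n) P (F k)) =
      EFin \o series (geometric e (1 - c)).
    apply/funext => n; rewrite /series/= -sumEFin; apply: eq_bigr => k _.
    by rewrite PF mulrC.
  apply: cvg_EFin; first exact: nearW.
  have := @cvg_geometric_series R e (1 - c).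
  rewrite opprB addrCA subrr addr0; apply.
  by rewrite ger0_norm ?subr_ge0// ltrBlDr ltrDl.
have -> : P (first_entry C D) = (e / c)%:E.
  rewrite feF; transitivity (limn (fun n => \sum_(0 <= k < n) P (F k))).
    by apply/esym; apply: (cvg_lim _ lim1).
  by apply: (cvg_lim _ lim2).
by rewrite muC muD -EFinM divfK// gt_eqF.
Qed.

End IndependentSequences.
(** * Laws of the first two ladder variables and partial products *)

Section LadderStep.
Variable S : ptopMonoidType.
Implicit Types (s : nat -> S) (K : set S).

Lemma translate_uset x K : translate x K `<=` uset x.
Proof. by move=> _ [k _ <-]; exists k. Qed.

(** When a ladder time exists, the second ladder variable is the first term to
    enter [uset (s 0)], so [translate (s 0) K] contains it exactly when the
    first entry falls there. *)
Lemma ladder1_translate s K : (exists k, sle (s 0%N) (s k.+1)) ->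
  translate (s 0%N) K (ladder s 1) <->
  exists k, (forall j, (j < k)%N -> ~ uset (s 0%N) (s j.+1)) /\
    translate (s 0%N) K (s k.+1).
Proof.
move=> [k0 s0k0]; rewrite /ladder /= /next_ladder_time.
case: pselect => [ex_k|noex]; last first.
  by exfalso; apply: noex; exists k0.+1; rewrite /is_later_above/=; apply/asboolP.
case: ex_minnP => -[|m]; rewrite /is_later_above//= => /asboolP s0m mmin.
have minm j : (j < m)%N -> ~ uset (s 0%N) (s j.+1).
  by move=> jm /asboolT s0j; have := mmin j.+1 s0j; rewrite ltnS leqNgt jm.
split=> [sm|[k [mink sk]]]; first by exists m.
have [km|mk|<-//] := ltngtP k m; last by case: (mink m mk).
by case: (minm k km); exact: translate_uset sk.
Qed.

Lemma ladder1_stuck s : ~ (exists k, sle (s 0%N) (s k.+1)) ->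
  ladder s 1 = s 0%N.
Proof.
move=> nok; rewrite /ladder /= /next_ladder_time; case: pselect => // ex_k.
exfalso; case: ex_k => -[|k]; rewrite /is_later_above//= => /asboolP s0k.
by apply: nok; exists k.
Qed.

End LadderStep.

Lemma pair_path_measurable d (T : measurableType d) (A : set (T * T)) :
  measurable A -> path_measurable [set w : nat -> T | A (w 0%N, w 1%N)].
Proof.
move=> mA.
pose G := \bigcup_n
  preimage_set_system setT (fun w : nat -> T => w n) measurable.
have coord n : measurable_fun setT (fun w : g_sigma_algebraType G => w n).
  move=> _ B mB; apply: sub_sigma_algebra; exists n => //; exists B => //.
have pair := measurable_fun_pair (coord 0%N) (coord 1%N).
by have := pair measurableT _ mA; rewrite setTI.
Qed.

Section LadderLaw.
Variables (R : realType) (S : ptopMonoidType).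
Variable lambda : {measure set (borelType S) -> \bar R}.
Hypothesis hS : standard_positive_semigroup lambda.
Context d (Omega : measurableType d) (P : probability Omega R).
Variable X : nat -> {RV P >-> borelType S}.
Hypothesis iidX : iid X.
Let mu := distribution P (X 0%N).
Hypothesis upf_gt0 : forall x : S, 0 < upf mu x.
Implicit Types (x y z : S) (K : set S).

Definition translate_graph K : set (borelType S * borelType S) :=
  [set yz | translate yz.1 K yz.2].

Lemma measurable_translate_graph K : compact K ->
  measurable (translate_graph K).
Proof.
move=> cK; have ct := std_second_countable hS.
apply: closed_measurable_prod => //.
exact: (std_translate_graph_closed hS cK).
Qed.

Lemma measurable_translate_graphT : measurable (translate_graph setT).
Proof.
have ct := std_second_countable hS; apply: closed_measurable_prod => //.
rewrite (_ : translate_graph _ = [set xy : S * S | sle xy.1 xy.2]).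
  exact: std_closed_order hS.
by apply/seteqP; split=> -[y z]; rewrite /translate_graph /= translateT.
Qed.

Definition entry_graph K :
    set (borelType S * g_sigma_algebraType (future_cylinders X)) :=
  [set yw | first_entry X (uset yw.1) (translate yw.1 K) yw.2].

Lemma measurable_entry_graph K : measurable (translate_graph K) ->
  measurable (entry_graph K).
Proof.
move=> mK.
pose next j (yw : borelType S * g_sigma_algebraType (future_cylinders X)) :
  borelType S * borelType S := (yw.1, X j.+1 yw.2).
have mnext j A : measurable A -> measurable (next j @^-1` A).
  move=> mA; rewrite -[_ @^-1` _]setTI.
  have mX : measurable_fun setT
      (X j.+1 : g_sigma_algebraType (future_cylinders X) -> borelType S).
    by move=> _ B mB; rewrite setTI; exact: sub_future.
  have : measurable_fun setT (next j).
    by apply: measurable_fun_pair => //; exact: measurableT_comp mX _.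
  exact.
have -> : entry_graph K = \bigcup_k
    ((\bigcap_(j < k) ~` (next j @^-1` translate_graph setT)) `&`
     next k @^-1` translate_graph K).
  apply/seteqP; split=> [[y w] [k [Cj Dk]]|[y w] [k _ [Cj Dk]]].
    exists k => //; split=> // j jk /=; rewrite /translate_graph /= translateT.
    exact: Cj.
  exists k; split=> // j jk; have := Cj j jk.
  by rewrite /translate_graph /= translateT.
apply: bigcupT_measurable => k; apply: measurableI; last exact: mnext.
apply: bigcap_measurableType => j _; apply: measurableC; apply: mnext.
exact: measurable_translate_graphT.
Qed.

Let entry_prob K y := P (first_entry X (uset y) (translate y K)).

Lemma entry_probE K y : measurable (translate y K : set (borelType S)) ->
  entry_prob K y * upf mu y = mu (translate y K).
Proof.
move=> mK; apply: first_entry_prob => //; last exact: upf_gt0.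
  exact: measurable_uset hS _.
exact: translate_uset.
Qed.

(** A later term in [uset y] exists almost surely: this is what makes the
    second ladder time almost surely a genuine minimum. *)
Lemma entry_probT y : entry_prob setT y = 1.
Proof.
have yT : translate y setT = uset y by exact: translateT.
have my := measurable_uset hS y.
have fy : upf mu y \is a fin_num by exact: fin_num_measure.
have : entry_prob setT y * upf mu y = upf mu y.
  by rewrite entry_probE yT.
move=> /(congr1 (fun u => u * (upf mu y)^-1)).
by rewrite -muleA divee// ?gt_eqF// mule1.
Qed.

Lemma entry_law A K : measurable A -> measurable (translate_graph K) ->
  P [set w | A (X 0%N w) /\ entry_graph K (X 0%N w, w)] =
  \int[mu]_(y in A) entry_prob K y.
Proof.
move=> mA mK; have mE := measurable_entry_graph mK.
have mAE : measurable (A `*` setT `&` entry_graph K).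
  by apply: measurableI => //; exact: measurableX.
rewrite integral_mkcond.
transitivity (P [set w | (A `*` setT `&` entry_graph K) (X 0%N w, w)]).
  by congr (P _); apply/seteqP; split=> w /= []; [|case].
rewrite (conditioning (@future_cylinders_measurable _ _ _ _ _ _ X)
  (independent_future iidX) mAE).
apply: eq_integral => y _; rewrite patchE; case: ifPn => [|] yA.
  congr (P _); apply/seteqP; split=> w /=; first by case.
  by split=> //; split=> //; rewrite inE in yA.
rewrite (_ : [set w | _] = set0) ?measure0//.
by apply/seteqP; split=> // w /= [[Ay _] _]; rewrite notin_setE in yA.
Qed.

(** The event differs from the first-entry event only on the complement of
    [later], where no second ladder time exists and which is null by
    [entry_probT]. *)
Lemma ladder_law A K : measurable A -> compact K ->
  P [set w | A (X 0%N w) /\ translate_graph K (X 0%N w, ladder_process X 1 w)] =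
  \int[mu]_(y in A) entry_prob K y.
Proof.
move=> mA cK; have mK := measurable_translate_graph cK.
pose event D := [set w | entry_graph D (X 0%N w, w)].
have mevent D : measurable (translate_graph D) -> measurable (event D).
  move=> mD; apply: measurable_graph_preimage (measurable_entry_graph mD).
  exact: future_cylinders_measurable.
have mpair i j D : measurable (translate_graph D) ->
    measurable [set w | translate_graph D (X i w, X j w)].
  move=> mD; have mXX : measurable_fun setT (fun w => (X i w, X j w)).
    by apply: measurable_fun_pair.
  by have := mXX measurableT _ mD; rewrite setTI.
have mT := mevent _ measurable_translate_graphT.
pose later := [set w | exists k, sle (X 0%N w : S) (X k.+1 w)].
have later_entry w : event setT w -> later w.
  by move=> [k [_ [t _ s0k]]]; exists k; exists t.
have mlater : measurable later.
  have -> : later = \bigcup_k [set w | translate_graph setT (X 0%N w, X k.+1 w)].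
    apply/seteqP; split=> [w [k [t s0k]]|w [k _ [t _ s0k]]].
      by exists k => //; exists t.
    by exists k, t.
  by apply: bigcupT_measurable => k; apply: mpair measurable_translate_graphT.
have Pevent : P (event setT) = 1.
  transitivity (P [set w | setT (X 0%N w) /\ event setT w]).
    by congr (P _); apply/seteqP; split=> w //= [].
  rewrite entry_law//; last exact: measurable_translate_graphT.
  under eq_integral do rewrite entry_probT.
  by rewrite integral_cst// mul1e; exact: probability_setT.
have Pnlater : P (~` later) = 0.
  apply: (@subset_measure0 _ _ _ P _ (~` event setT)).
  - exact: measurableC.
  - exact: measurableC.
  - by move=> w nl Tw; apply: nl; exact: later_entry.
  - transitivity (1 - P (event setT)); last by rewrite Pevent subee.
    exact: probability_setC.
rewrite -entry_law//.
set L := [set w | _]; set E := [set w | _].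
pose M := ~` later `&`
  (X 0%N @^-1` A `&` [set w | translate_graph K (X 0%N w, X 0%N w)]).
have mM : measurable M.
  apply: measurableI; first exact: measurableC.
  by apply: measurableI; [exact: (measurable_preimage X 0 mA)|exact: mpair].
have mE : measurable E.
  by apply: measurableI; [exact: (measurable_preimage X 0 mA)|exact: mevent].
have -> : L = E `|` M.
  apply/seteqP; split=> [w [Aw Kw]|w].
    have [lw|nlw] := pselect (later w).
      by left; split=> //; exact: (@ladder1_translate S (X ^~ w) K lw).1 Kw.
    right; split=> //; split=> //; move: Kw.
    by rewrite /translate_graph/= /ladder_process ladder1_stuck.
  move=> [[Aw Ew]|[nlw [Aw Kw]]]; split=> //.
    have lw : later w by have [k [_ [t _ s0k]]] := Ew; exists k, t.
    exact: (@ladder1_translate S (X ^~ w) K lw).2 Ew.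
  by rewrite /translate_graph/= /ladder_process ladder1_stuck.
rewrite measureU//.
  rewrite [X in _ + X](_ : _ = 0) ?adde0//.
  apply: subset_measure0 Pnlater => //; [exact: measurableC|by move=> w []].
apply/seteqP; split=> // w [[_ Ew] [nlw _]]; apply: nlw.
by have [k [_ [t _ s0k]]] := Ew; exists k, t.
Qed.

Lemma partial_product_law A K : measurable A -> compact K ->
  P [set w | A (X 0%N w) /\
    translate_graph K (X 0%N w, partial_product_process X 1 w)] =
  mu A * mu K.
Proof.
move=> mA cK; have mK := compact_measurable hS cK.
transitivity (P (\bigcap_(i < 2) X i @^-1` (if i == 0%N then A else K))).
  congr (P _); apply/seteqP; split=> [w [Aw]|w AKw].
    rewrite /translate_graph /partial_product_process /partial_product /=.
    rewrite !big_ord_recl big_ord0 mulg1 => -[k Kk /(std_mulgI hS) kX].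
    by move=> [|[|i]] //= _; rewrite -[X 1%N w]kX.
  split; first exact: (AKw 0%N).
  rewrite /translate_graph /partial_product_process /partial_product /=.
  rewrite !big_ord_recl big_ord0 mulg1; exists (X 1%N w) => //.
  exact: (AKw 1%N).
rewrite (independent_cylinder iidX); last by move=> i; case: ifP.
by rewrite !big_ord_recl big_ord0/= mule1 !(identical_distribution iidX).
Qed.

(** The two laws give [entry_prob K] and the constant [mu K] the same integral
    over every Borel set. *)
Lemma ae_exponential_on_compact K :
  equivalent_processes P (ladder_process X) (partial_product_process X) ->
  compact K -> {ae mu, forall y, mu (translate y K) = upf mu y * mu K}.
Proof.
move=> equivYZ cK; have mK := compact_measurable hS cK.
have mE := measurable_entry_graph (measurable_translate_graph cK).
have entry_ae : ae_eq mu setT (cst (mu K)) (entry_prob K).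
  apply: integral_ae_eq => //.
  - rewrite [cst _](_ : _ = EFin \o cst (fine (mu K))); last first.
      by apply: funext => y /=; rewrite fineK//; exact: fin_num_measure.
    exact: finite_measure_integrable_cst.
  - exact: measurable_section (@future_cylinders_measurable _ _ _ _ _ _ X) _ mE.
  move=> A _ mA; rewrite integral_cst//.
  have mAK : measurable (A `*` setT `&` translate_graph K).
    apply: measurableI; first exact: measurableX.
    exact: measurable_translate_graph.
  have event_eq (V : nat -> Omega -> borelType S) : V 0%N = X 0%N ->
      [set w | A (X 0%N w) /\ translate_graph K (X 0%N w, V 1%N w)] =
      [set w | (A `*` setT `&` translate_graph K) (V 0%N w, V 1%N w)].
    by move=> ->; apply/seteqP; split=> w; [case|case=> -[]].
  rewrite -ladder_law// muleC -partial_product_law// (event_eq (ladder_process X))//.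
  rewrite (event_eq (partial_product_process X)); last first.
    apply/funext => w; rewrite /partial_product_process /partial_product /=.
    by rewrite big_ord_recl big_ord0 mulg1.
  by apply/esym; exact: equivYZ _ (pair_path_measurable mAK).
apply: filterS entry_ae => y /(_ I) /= Ky.
rewrite -entry_probE; last exact: (compact_measurable hS (std_translate_compact hS cK)).
by rewrite -Ky muleC.
Qed.

End LadderLaw.
Lemma pdf_null_dominates (R : realType) (S : ptopMonoidType)
    (lambda : {measure set (borelType S) -> \bar R})
    (mu : probability (borelType S) R) (f : borelType S -> R) :
  is_pdf mu lambda f -> forall A : set (borelType S), measurable A ->
  lambda A = 0 -> mu A = 0.
Proof.
move=> [mf _ muE] A mA A0; rewrite muE//; apply: null_set_integral => //.
by apply/measurable_EFinP; exact: measurable_funTS.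
Qed.

Theorem proposition10 (R : realType) (S : ptopMonoidType)
  (lambda : {measure set (borelType S) -> \bar R})
  (hS : standard_positive_semigroup lambda)
  (d : measure_display) (Omega : measurableType d) (P : probability Omega R)
  (X : nat -> {RV P >-> borelType S})
  (hiid : iid X)
  (hsupp : measure_support (distribution P (X 0%N)) = [set: S])
  (hF : forall x : S, 0 < upf (distribution P (X 0%N)) x <= 1)
  (hpdf : exists f : borelType S -> R,
     forall i : nat, is_pdf (distribution P (X i)) lambda f)
  (hYZ : equivalent_processes P (ladder_process X)
     (partial_product_process X)) :
  is_exponential (distribution P (X 0%N)).
Proof.
have [f /(_ 0%N) f_pdf] := hpdf.
have F_gt0 x : 0 < upf (distribution P (X 0%N)) x by case/andP: (hF x).
apply: (exponential_of_ae hS) => //; first exact: pdf_null_dominates f_pdf.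
by move=> K cK; exact: (ae_exponential_on_compact hS hiid F_gt0 hYZ cK).
Qed.
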